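(* Let $n\ge 1$ be an integer and let $\varphi\in C(\mathbb R^n)\cap L^\infty(\mathbb R^n)$, $\varphi\ge 0$, $\varphi\not\equiv 0$. Consider the function $f(x,t)=P_t\varphi(x)$ for $x\in\mathbb R^n$, $t>0$, and let $u(x,t)=\log f(x,t)$. Then for every $x\in\mathbb R^n$ and $t>0$ $$|\nabla_x u(x,t)|^2-u_t(x,t)\le\frac{n}{2t} .$$
   Context: $P_t\varphi(x)=\int_{\mathbb R^n}G(x-y,t)\,\varphi(y)\,dy$ is the classical heat semigroup, with $G(x,t)=(4\pi t)^{-n/2}e^{-|x|^2/(4t)}$; $u_t=\partial u/\partial t$. *)

(* Defs.v *)
From HB Require Import structures.
From mathcomp Require Import all_boot all_order all_algebra.
From mathcomp Require Import all_classical all_reals all_analysis.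

Set Implicit Arguments.
Unset Strict Implicit.
Unset Printing Implicit Defensive.

Import Order.TTheory GRing.Theory Num.Theory.
Import numFieldNormedType.Exports.

Local Open Scope classical_set_scope.
Local Open Scope ring_scope.

Section lebesgue_step.
Context {R : realType} (n : nat).
Notation T := (measurableTypeR R).
Variable mu : {sigma_finite_measure set (n.-tuple T) -> \bar R}.

Definition tcons (p : T * n.-tuple T) : n.+1.-tuple T :=
  [the n.+1.-tuple T of p.1 :: p.2].

Lemma measurable_tcons : measurable_fun [set: T * n.-tuple T] tcons.
Proof. exact: (measurable_cons measurable_fst measurable_snd). Qed.

Definition lebesgue_step : set (n.+1.-tuple T) -> \bar R :=
  pushforward (@lebesgue_measure R \x mu)%E tcons.

Let lebesgue_step0 : lebesgue_step set0 = 0%E.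
Proof. by rewrite /lebesgue_step /pushforward preimage_set0 measure0. Qed.

Let lebesgue_step_ge0 A : (0 <= lebesgue_step A)%E.
Proof. by rewrite /lebesgue_step /pushforward measure_ge0. Qed.

Let lebesgue_step_sigma_additive : semi_sigma_additive lebesgue_step.
Proof.
move=> F mF tF mUF; rewrite /lebesgue_step /pushforward preimage_bigcup.
apply: measure_semi_sigma_additive.
- by move=> k; rewrite -[X in measurable X]setTI; exact: measurable_tcons.
- apply/trivIsetP => /= i j _ _ ij; rewrite -preimage_setI.
  by move/trivIsetP : tF => /(_ _ _ _ _ ij) ->//; rewrite preimage_set0.
- by rewrite -preimage_bigcup -[X in measurable X]setTI;
    exact: measurable_tcons.
Qed.

HB.instance Definition _ := isMeasure.Build _ _ _ lebesgue_step
  lebesgue_step0 lebesgue_step_ge0 lebesgue_step_sigma_additive.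

Let tuncons (y : n.+1.-tuple T) : T * n.-tuple T :=
  (thead y, [tuple of behead y]).

Let tconsK : cancel tcons tuncons.
Proof. by case=> x y; congr pair; apply/val_inj. Qed.

Let measurable_tuncons : measurable_fun [set: n.+1.-tuple T] tuncons.
Proof.
apply/measurable_fun_pairP; split; first exact: measurable_tnth.
exact: measurable_behead.
Qed.

Let lebesgue_step_sigma_finite : sigma_finite setT lebesgue_step.
Proof.
have /sigma_finiteP[F [TF ndF Foo]] := sigma_finiteT (@lebesgue_measure R).
have /sigma_finiteP[G [TG ndG Goo]] := sigma_finiteT mu.
exists (fun k => tuncons @^-1` (F k `*` G k)).
  rewrite -preimage_bigcup (_ : \bigcup_k _ = setT) ?preimage_setT//.
  apply/seteqP; split=> // -[x y] _.
  have [i _ Fx] : (\bigcup_i F i) x by rewrite -TF.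
  have [j _ Gy] : (\bigcup_i G i) y by rewrite -TG.
  exists (maxn i j) => //; split=> /=.
    by move: x Fx; exact/subsetPset/ndF/leq_maxl.
  by move: y Gy; exact/subsetPset/ndG/leq_maxr.
move=> k; have [mF Fk] := Foo k; have [mG Gk] := Goo k; split.
  rewrite -[X in measurable X]setTI; apply: measurable_tuncons => //.
  exact: measurableX.
rewrite /lebesgue_step /pushforward -comp_preimage.
rewrite (_ : tuncons \o tcons = id) ?preimage_id; last exact/funext/tconsK.
by rewrite product_measure1E// lte_mul_pinfty// ge0_fin_numE.
Qed.

HB.instance Definition _ := Measure_isSigmaFinite.Build _ _ _ lebesgue_step
  lebesgue_step_sigma_finite.

End lebesgue_step.

(* Lebesgue measure on the Borel sets of R^n, as the n-fold product of the
   one-dimensional Lebesgue measure; points of R^n are represented by tuples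
   because these carry the product sigma-algebra in the library *)
Fixpoint lebesgue_tuple {R : realType} (n : nat) :
    {sigma_finite_measure set (n.-tuple (measurableTypeR R)) -> \bar R} :=
  match n with
  | 0 => \d_([tuple] : 0.-tuple (measurableTypeR R))
  | m.+1 => lebesgue_step (lebesgue_tuple m)
  end.

Lemma lebesgue_tuple_box {R : realType} (n : nat)
    (A : 'I_n -> set (measurableTypeR R)) :
  (forall i, measurable (A i)) ->
  measurable [set y : n.-tuple (measurableTypeR R) | forall i, A i (tnth y i)]
  /\ lebesgue_tuple n [set y | forall i, A i (tnth y i)] =
     (\prod_(i < n) lebesgue_measure (A i))%E.
Proof.
elim: n A => [|n IH] A mA.
  have -> : [set y : 0.-tuple (measurableTypeR R) | forall i, A i (tnth y i)] = setT.
    by apply/seteqP; split => // y _ [].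
  by split; [exact: measurableT | rewrite big_ord0 /= diracT].
have [mB IHe] := IH (fun i => A (lift ord0 i)) (fun i => mA _).
split.
  rewrite (_ : mkset _ = \bigcap_(i in [set: 'I_n.+1]) ((@tnth _ (measurableTypeR R))^~ i @^-1` A i)); last first.
    by apply/seteqP; split => y /=; [move=> H i _; exact: H|move=> H i; exact: (H i I)].
  apply: fin_bigcap_measurable => // i _.
  by rewrite -[X in measurable X]setTI; exact: measurable_tnth.
rewrite big_ord_recl -IHe /=.
rewrite /lebesgue_step /pushforward.
rewrite -(product_measure1E _ _ (mA ord0) mB).
congr (product_measure1 _ _ _); apply/seteqP; split => -[x y] /=.
  move=> H; split; first exact: (H ord0).
  by move=> i; have := H (lift ord0 i); rewrite /tcons /= tnthS.
move=> [H1 H2] i; case: (unliftP ord0 i) => [j|] ->; first by rewrite /tcons tnthS; exact: H2.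
exact: H1.
Qed.

Section heat.
Context {R : realType} {n : nat}.
Implicit Types (x v : 'rV[R]_n) (phi : 'rV[R]_n -> R) (t : R).

Definition vec (y : n.-tuple (measurableTypeR R)) : 'rV[R]_n :=
  \row_(i < n) tnth y i.

(* the library norm `|x| on 'rV[R]_n is the sup norm *)
Definition enorm x : R := Num.sqrt (\sum_(i < n) x ord0 i ^+ 2).

Definition heat_kernel x t : R :=
  (4 * pi * t) `^ (- (n%:R / 2)) * expR (- (enorm x ^+ 2 / (4 * t))).

Definition heat_semigroup t phi x : R :=
  \int[lebesgue_tuple n]_(y in setT) (heat_kernel (x - vec y) t * phi (vec y)).

Definition Linfty phi : Prop :=
  finite_norm (lebesgue_tuple n) +oo%E (phi \o vec).

Definition grad (h : 'rV[R]_n -> R) x : 'rV[R]_n :=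
  \row_(i < n) 'D_(delta_mx ord0 i) h x.

End heat.

(* Main.v *)
(* Differentiating under the integral sign, with weight
   w(y) = G(x - y, t) phi(y) and W = P_t phi(x), gives
     d_i f = - (1 / 2t) int (x_i - y_i) w,
     f_t   = (1 / 4t^2) int |x - y|^2 w - (n / 2t) W.
   Hence the inequality |grad f|^2 / f^2 - f_t / f <= n / 2t amounts to
   sum_i (int (x_i - y_i) w)^2 <= W * int |x - y|^2 w, which is
   Cauchy-Schwarz for the measure w dy in each coordinate. *)
Require Import Defs.
From HB Require Import structures.
From mathcomp Require Import all_boot all_order all_algebra.
From mathcomp Require Import ring lra.
From mathcomp Require Import all_classical all_reals all_analysis.
From mathcomp Require Import measurable_realfun ess_sup_inf
  lebesgue_integral_under.

Set Implicit Arguments.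
Unset Strict Implicit.
Unset Printing Implicit Defensive.

Import Order.TTheory GRing.Theory Num.Theory.
Import numFieldNormedType.Exports.

Local Open Scope classical_set_scope.
Local Open Scope ring_scope.

(** * Measurability and Tonelli integration on tuples, and the one-dimensional Gaussian *)

Section tuple_integration.
Context {R : realType}.
Implicit Types n : nat.

(* [phi \o vec] is the limit of its values at the points [floor (k y) / k], which
   take only countably many values for each [k]. *)
Lemma measurable_comp_vec n (phi : 'rV[R]_n -> R) :
  continuous phi -> measurable_fun setT (phi \o vec).
Proof.
move=> phi_cont.
pose z k (y : n.-tuple (measurableTypeR R)) : {ffun 'I_n -> int} :=
  [ffun i => Num.floor (k.+1%:R * tnth y i)].
pose p k (m : {ffun 'I_n -> int}) : 'rV[R]_n := \row_i ((m i)%:~R / k.+1%:R).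
apply: (@measurable_fun_cvg _ _ _ _ (fun k y => phi (p k (z k y)))).
  move=> k _ Y mY; rewrite setTI.
  (* The fibre of [z k] over [m] is a half-open box of side [1/(k+1)], measurable by
     [lebesgue_tuple_box]; the preimage is the countable union of the boxes whose corner value lies
     in [Y]. *)
  rewrite (_ : _ @^-1` _ = \bigcup_(m : {ffun 'I_n -> int})
      (if phi (p k m) \in Y then [set y | forall i,
        `[(m i)%:~R / k.+1%:R, (m i + 1)%:~R / k.+1%:R[%classic (tnth y i)]
       else set0)); last first.
    have E (m : {ffun _ -> _}) y : (forall i, `[(m i)%:~R / k.+1%:R,
        (m i + 1)%:~R / k.+1%:R[%classic (tnth y i)) <-> z k y = m.
      split=> [H|<- i].
        apply/ffunP => i; rewrite ffunE; apply: floor_def.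
        have := H i; rewrite /= in_itv/= ler_pdivrMr// ltr_pdivlMr//.
        by rewrite mulrC.
      rewrite /= in_itv/= ler_pdivrMr// ltr_pdivlMr// ffunE mulrC.
      exact: floor_itv.
    apply/seteqP; split=> [y /= Yy|y [m _]].
      exists (z k y) => //; rewrite mem_set//=; exact/E.
    by case: ifPn => // /set_mem Ym /E zy; rewrite /= zy.
  apply: countable_bigcupT_measurable => [|m]; first exact: countableP.
  case: ifPn => // _.
  by have [] := @lebesgue_tuple_box R n (fun i => `[(m i)%:~R / k.+1%:R,
    (m i + 1)%:~R / k.+1%:R[%classic) (fun i => measurable_itv _).
move=> y _ /=.
apply: (@continuous_cvg _ _ _ _ _ (fun k => p k (z k y)) phi).
  exact: phi_cont.
apply/cvgrPdist_lt => e e0.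
near=> k.
(* For the sup norm it suffices to bound each coordinate, where rounding down costs at most
   [1/(k+1)]. *)
rewrite -[X in X < e]/(`|_|) [`|_|]mx_normrE.
apply/bigmax_ltP; split=> // -[a i] _ /=.
rewrite !mxE ffunE /=.
have := floor_itv (k.+1%:R * tnth y i).
set m := Num.floor _ => /andP[H1 H2].
have k0 : 0 < k.+1%:R :> R by [].
rewrite ger0_norm; last by rewrite subr_ge0 ler_pdivrMr// mulrC.
apply: (@le_lt_trans _ _ k.+1%:R^-1).
  rewrite lerBlDr -[X in X + _]mul1r -mulrDl ler_pdivlMr// mulrC ltW//.
  by rewrite (lt_le_trans H2)// intrD addrC.
near: k; exact: (near_infty_natSinv_lt (PosNum e0)).
Unshelve. all: by end_near. Qed.

(** Induction on [n]: the measure on longer tuples is the image of a product measure, so Tonelli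
    splits off the first coordinate and leaves a product of two finite integrals. *)
Lemma integral_tuple_prod_lty n (g : 'I_n -> R -> R) :
  (forall i, measurable_fun setT (g i)) -> (forall i r, 0 <= g i r) ->
  (forall i, (\int[lebesgue_measure]_r (g i r)%:E < +oo)%E) ->
  (\int[lebesgue_tuple n]_y (\prod_(i < n) g i (tnth y i))%:E < +oo)%E.
Proof.
elim: n g => [|n IH] g mg g0 goo.
  under eq_integral do rewrite big_ord0.
  rewrite integral_cst//= diracT mule1; exact: ltry.
have mprod m (h : 'I_m -> R -> R) : (forall i, measurable_fun setT (h i)) ->
    measurable_fun setT (fun y : m.-tuple (measurableTypeR R) =>
      (\prod_(i < m) h i (tnth y i))%:E).
  move=> mh; apply/measurable_EFinP; apply: measurable_prod => i _.
  by apply: measurableT_comp; [exact: mh|exact: measurable_tnth].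
have h0 y : 0 <= \prod_(i < n) g (lift ord0 i) (tnth y i).
  by apply: prodr_ge0.
rewrite [X in (X < _)%E](_ : _ =
    \int[lebesgue_measure \x lebesgue_tuple n]_p
      (g ord0 p.1 * \prod_(i < n) g (lift ord0 i) (tnth p.2 i))%:E)%E;
  last first.
  rewrite /= (@ge0_integral_pushforward _ _ _ _ _ _ (@measurable_tcons R n))//=.
  - apply: eq_integral => -[x y] _ /=; rewrite big_ord_recl /=.
    by congr (_ * _)%:E; apply: eq_bigr => i _; rewrite /tcons tnthS.
  - exact: mprod.
  - by move=> y _; rewrite lee_fin prodr_ge0.
rewrite fubini_tonelli1//=; last 2 first.
- apply/measurable_EFinP/measurable_funM.
    by apply: measurableT_comp; [exact: mg|exact: measurable_fst].
  apply: measurable_prod => i _; apply: measurableT_comp; first exact: mg.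
  exact: (measurableT_comp (measurable_tnth i) measurable_snd).
- by move=> p; rewrite lee_fin mulr_ge0.
rewrite /fubini_F /=.
pose K := (\int[lebesgue_tuple n]_y
  (\prod_(i < n) g (lift ord0 i) (tnth y i))%:E)%E.
have K0 : (0 <= K)%E by apply: integral_ge0 => y _; rewrite lee_fin.
rewrite [X in (X < _)%E](_ : _ =
    \int[lebesgue_measure]_x ((g ord0 x)%:E * K))%E; last first.
  apply: eq_integral => x _; rewrite -ge0_integralZl_EFin//.
    by move=> y _; rewrite lee_fin.
  exact: (mprod _ (fun i => g (lift ord0 i))).
rewrite ge0_integralZr//=; last 2 first.
- by apply: measurableT_comp => //; exact: (mg ord0).
- by move=> x _; rewrite lee_fin.
apply: lte_mul_pinfty => //.
- by apply: integral_ge0 => y _; rewrite lee_fin.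
- rewrite ge0_fin_numE ?goo//.
  by apply: integral_ge0 => y _; rewrite lee_fin.
- by apply: (IH (fun i => g (lift ord0 i))) => i *;
    [exact: mg|exact: g0|exact: goo].
Qed.

(** Up to the positive factor [normal_peak s], the integrand is the normal density of mean [a] and
    variance [s^2 = 1/(2c)]. An infinite integral would stay infinite after multiplication by that
    factor, whereas the density integrates to 1. *)
Lemma integral_gauss_lty (a c : R) : 0 < c ->
  (\int[lebesgue_measure]_r (expR (- (c * (a - r) ^+ 2)))%:E < +oo)%E.
Proof.
move=> c0; pose s := Num.sqrt (2 * c)^-1.
have c20 : 0 < (2 * c)^-1 by rewrite invr_gt0 mulr_gt0.
have s0 : s != 0 by rewrite gt_eqF// sqrtr_gt0.
have := integral_normal_pdf a s.
have -> : normal_pdf a s =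
    (fun r => normal_peak s * expR (- (c * (a - r) ^+ 2))).
  rewrite normal_pdfE//; apply/funext => r; rewrite /normal_fun.
  congr (_ * expR _); rewrite sqr_sqrtr ?ltW//.
  have c1 : c != 0 by rewrite gt_eqF.
  by field.
under eq_integral do rewrite EFinM.
rewrite ge0_integralZl_EFin//; last first.
- exact: normal_peak_ge0.
- apply/measurable_EFinP; apply: measurableT_comp => //.
  by apply: measurableT_comp => //; apply: measurable_funM => //;
    apply: measurable_funX; apply: measurable_funB.
move=> H; rewrite ltNge leye_eq; apply/negP => /eqP Hoo.
move: H; rewrite Hoo gt0_muley ?lte_fin ?normal_peak_gt0//.
Qed.
End tuple_integration.

(** * Gaussian domination of integrands containing [phi] *)

Section heat_integrability.
Context {R : realType} {n : nat}.
Implicit Types (x z : 'rV[R]_n) (c C : R).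
Variable phi : 'rV[R]_n -> R.
Hypothesis phi_cont : continuous phi.
Hypothesis phi_Linfty : Linfty phi.

Local Notation mu := (@lebesgue_tuple R n).

Lemma enorm_sqr z : enorm z ^+ 2 = \sum_(i < n) z ord0 i ^+ 2.
Proof. by rewrite sqr_sqrtr// sumr_ge0// => i _; exact: sqr_ge0. Qed.

Lemma enorm_sqr_subvec x (y : n.-tuple (measurableTypeR R)) :
  enorm (x - vec y) ^+ 2 = \sum_(i < n) (x ord0 i - tnth y i) ^+ 2.
Proof. by rewrite enorm_sqr; apply: eq_bigr => i _; rewrite !mxE. Qed.

Lemma coord_sub_sqr_le x (y : n.-tuple (measurableTypeR R))
    (i : 'I_n) :
  (x ord0 i - tnth y i) ^+ 2 <= enorm (x - vec y) ^+ 2.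
Proof.
rewrite enorm_sqr_subvec (bigD1 i)//= lerDl sumr_ge0// => j _.
exact: sqr_ge0.
Qed.

Lemma measurable_coord_sub x i : measurable_fun setT
  (fun y : n.-tuple (measurableTypeR R) => x ord0 i - tnth y i).
Proof. by apply: measurable_funB => //; exact: measurable_tnth. Qed.

Lemma measurable_enorm_sqr_sub x : measurable_fun setT
  (fun y : n.-tuple (measurableTypeR R) => enorm (x - vec y) ^+ 2).
Proof.
under eq_fun do rewrite enorm_sqr_subvec.
apply: measurable_sum => i; apply: measurable_funX.
exact: measurable_coord_sub.
Qed.

Lemma measurable_gauss x c : measurable_fun setT
  (fun y : n.-tuple (measurableTypeR R) =>
    expR (- (c * enorm (x - vec y) ^+ 2))).
Proof.
apply: measurableT_comp => //; apply: measurableT_comp => //.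
by apply: measurable_funM => //; exact: measurable_enorm_sqr_sub.
Qed.

Lemma gauss_lty x c : 0 < c ->
  (\int[mu]_y (expR (- (c * enorm (x - vec y) ^+ 2)))%:E < +oo)%E.
Proof.
move=> c0.
rewrite (_ : (fun y => _) = (fun y => (\prod_(i < n)
    expR (- (c * (x ord0 i - tnth y i) ^+ 2)))%:E)); last first.
  apply/funext => y; rewrite enorm_sqr_subvec mulr_sumr -sumrN expR_sum.
  by [].
apply: (@integral_tuple_prod_lty _ _
  (fun i r => expR (- (c * (x ord0 i - r) ^+ 2)))) => [i|i r|i].
- by apply: measurableT_comp => //; apply: measurableT_comp => //;
    apply: measurable_funM => //; apply: measurable_funX;
    apply: measurable_funB.
- exact: expR_ge0.
- exact: integral_gauss_lty.
Qed.

Lemma Linfty_ae_bounded :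
  exists2 M : R, 0 <= M & \forall y \ae mu, `|phi (vec y)| <= M.
Proof.
have := phi_Linfty; rewrite /Linfty /finite_norm unlock /=.
(* On a space of measure zero the norm is 0 by convention, and there any bound holds almost
   everywhere. *)
case: ifPn => [_|]; last first.
  rewrite -leNgt measure_le0 => /eqP mu0 _; exists 0 => //.
  by exists setT; split.
have := ess_sup_ge mu (abse \o (EFin \o (phi \o vec))).
(* The essential supremum is an extended real: [+oo] contradicts finiteness, and [-oo] would bound
   an absolute value by [-oo] almost everywhere, from which anything follows. *)
case: ess_sup => [r H _|//|H _].
  exists `|r| => //; apply: filterS H => y /=; rewrite lee_fin => H.
  by rewrite (le_trans H)// ler_norm.
by exists 0 => //; apply: filterS H => y /=; rewrite leeNy_eq.
Qed.

(** With [M] an almost everywhere bound of [phi], the product is dominated by [C * M] times a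
    Gaussian centred at [x]. The integrability of the kernel, of the dominating functions and of the
    moments is reduced to this. *)
Lemma integrable_gauss_dom x c C (h : n.-tuple (measurableTypeR R) -> R) :
  0 < c -> measurable_fun setT h ->
  (forall y, `|h y| <= C * expR (- (c * enorm (x - vec y) ^+ 2))) ->
  mu.-integrable setT (EFin \o (fun y => h y * phi (vec y))).
Proof.
move=> c0 mh hC; have [M M0 phiM] := Linfty_ae_bounded.
have mphi := measurable_comp_vec phi_cont.
(* The bound on [h] at one point, here the zero tuple, forces the sign of [C]. *)
have C0 : 0 <= C.
  have := le_trans (normr_ge0 _) (hC [tuple of nseq n 0]).
  by rewrite pmulr_lge0// expR_gt0.
apply/integrableP; split; first by apply/measurable_EFinP/measurable_funM.
apply: (@le_lt_trans _ _ (\int[mu]_y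
    ((C * M)%:E * (expR (- (c * enorm (x - vec y) ^+ 2)))%:E))%E).
  apply: ae_ge0_le_integral => //.
  - by apply: measurableT_comp => //; apply/measurable_EFinP/measurable_funM.
  - by move=> y _; rewrite -EFinM lee_fin !mulr_ge0// expR_ge0.
  - apply/measurable_EFinP/measurable_funM => //.
    exact: measurable_gauss.
  - apply: filterS phiM => y + _; move=> phiM; rewrite /= lee_fin normrM mulrAC.
    exact: ler_pM.
rewrite ge0_integralZl_EFin//.
- by rewrite lte_mul_pinfty ?gauss_lty// ?lee_fin ?mulr_ge0.
- by apply/measurable_EFinP; exact: measurable_gauss.
- exact: mulr_ge0.
Qed.

End heat_integrability.

(** * Positivity of the heat semigroup *)

Section heat_positivity.
Context {R : realType} {n : nat}.
Implicit Types (x z : 'rV[R]_n) (t : R).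
Variable phi : 'rV[R]_n -> R.
Hypothesis phi_cont : continuous phi.
Hypothesis phi_Linfty : Linfty phi.

Local Notation mu := (@lebesgue_tuple R n).

Lemma heat_kernelE z t : heat_kernel z t =
  (4 * pi * t) `^ (- (n%:R / 2)) * expR (- ((4 * t)^-1 * enorm z ^+ 2)).
Proof. by rewrite /heat_kernel [X in expR (- X)]mulrC. Qed.

Lemma heat_kernel_gt0 z t : 0 < t -> 0 < heat_kernel z t.
Proof.
by move=> t0; rewrite mulr_gt0 ?expR_gt0// powR_gt0 ?mulr_gt0 ?pi_gt0.
Qed.

Lemma measurable_heat_kernel_sub x t : measurable_fun setT
  (fun y : n.-tuple (measurableTypeR R) => heat_kernel (x - vec y) t).
Proof.
under eq_fun do rewrite heat_kernelE.
by apply: measurable_funM => //; exact: measurable_gauss.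
Qed.

Lemma integrable_heat x t : 0 < t -> mu.-integrable setT
  (EFin \o (fun y => heat_kernel (x - vec y) t * phi (vec y))).
Proof.
move=> t0; apply: (@integrable_gauss_dom _ _ _ phi_cont phi_Linfty x (4 * t)^-1
  ((4 * pi * t) `^ (- (n%:R / 2)))).
- by rewrite invr_gt0 mulr_gt0.
- exact: measurable_heat_kernel_sub.
- by move=> y; rewrite ger0_norm ?heat_kernelE// mulr_ge0 ?powR_ge0 ?expR_ge0.
Qed.

Lemma measure_cube_gt0 x (e : R) : 0 < e ->
  (0 < mu [set y | forall i, ball (x ord0 i) e (tnth y i)])%E.
Proof.
move=> e0; have [_ ->] := @lebesgue_tuple_box R n
  (fun i => ball (x ord0 i) e) (fun i => measurable_ball _ _).
elim/big_ind: _ => [|a b a0 b0|i _]; first exact: lte01.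
  exact: mule_gt0.
by rewrite lebesgue_measure_ball ?ltW// lte_fin mulrn_wgt0.
Qed.

(** If the integral of the nonnegative integrand were zero, the integrand would vanish outside a
    null set. By continuity [phi] is nonzero on a cube around [z], and the kernel is positive
    everywhere, so that null set would contain a cube of positive measure. *)
Lemma heat_semigroup_gt0 x t : (forall y, 0 <= phi y) ->
  (exists y, phi y != 0) -> 0 < t -> 0 < heat_semigroup t phi x.
Proof.
move=> phi0 [z phiz] t0.
have Kphi0 y : 0 <= heat_kernel (x - vec y) t * phi (vec y).
  by rewrite mulr_ge0// ltW// heat_kernel_gt0.
rewrite lt_neqAle; apply/andP; split; last exact: Rintegral_ge0.
apply/eqP => /esym f0.
have [e e0 phie] : exists2 e : R, 0 < e & forall y, ball z e y -> phi y != 0.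
  have : \forall y \near z, phi y != 0.
    exact: (cvgr_neq0 (phi z) (@phi_cont z) phiz).
  by move=> /nbhs_ballP[e e0 H]; exists e.
have := integrable_heat x t0; move=> /[dup] intK.
move=> /integrableP[mK _].
(* The real-valued integral is [fine] of an extended one, and [fine] also sends [+oo] to 0;
   integrability excludes that case. *)
have : (\int[mu]_y `|(heat_kernel (x - vec y) t * phi (vec y))%:E| = 0)%E.
  have := integrable_fin_num measurableT intK.
  move=> /fineK; rewrite [X in X%:E](_ : _ = 0)// => K0.
  rewrite -[RHS]/0%:E K0; apply: eq_integral => y _.
  by rewrite gee0_abs// lee_fin.
move=> /(ae_eq_integral_abs mu measurableT mK)[N [mN N0 KN]].
have := measure_cube_gt0 z e0; rewrite ltNge; apply/negP; rewrite negbK -N0.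
have [mB _] := @lebesgue_tuple_box R n
  (fun i => ball (z ord0 i) e) (fun i => measurable_ball _ _).
apply: le_measure; rewrite ?inE// => y By; apply: KN => /= H.
have /eqP := H I; rewrite eqe mulf_eq0 gt_eqF ?heat_kernel_gt0//=.
apply/negP/phie; split=> // i j; rewrite [i]ord1 !mxE; exact: By.
Qed.

End heat_positivity.

(** * Derivatives of the heat kernel in time and along a coordinate line *)

Section heat_derivatives.
Context {R : realType} {n : nat}.
Implicit Types (x y z : 'rV[R]_n) (h s t : R) (i : 'I_n).

(** Logarithmic differentiation: near [s] the kernel is the exponential of [E], so its derivative is
    [E'] times itself. The exponential form needs [r > 0], which holds in a neighbourhood of [s]. *)
Lemma is_derive_heat_kernel_time z s : 0 < s ->
  is_derive s 1 (heat_kernel z)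
    ((enorm z ^+ 2 / (4 * s ^+ 2) - n%:R / (2 * s)) * heat_kernel z s).
Proof.
move=> s0; set q := enorm z ^+ 2.
pose E r := - (n%:R / 2) * ln (4 * pi * r) + - (q / 4) * r^-1.
have pi0 := pi_gt0 R.
have KE r : 0 < r -> heat_kernel z r = expR (E r).
  move=> r0; have p0 : 0 < 4 * pi * r by rewrite !mulr_gt0.
  rewrite heat_kernelE /powR gt_eqF// -expRD; congr (expR (_ + _)).
  by rewrite -/q; field; rewrite gt_eqF.
apply: (@near_eq_is_derive _ _ _ (expR \o E)).
  by near=> r; rewrite KE//; near: r; exact: lt_nbhsr.
rewrite (KE s s0) [X in is_derive _ _ _ X]mulrC.
apply: (is_derive1_comp (is_derive_expR (E s))).
have -> : E = (- (n%:R / 2)) *: (@ln R \o (fun r => (4 * pi) *: r)) +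
    (- (q / 4)) *: (fun r : R => r^-1) by [].
have Dmul : is_derive s 1 (fun r : R => (4 * pi) *: r) (4 * pi).
  by apply: is_derive_eq; rewrite -[RHS]mulr1.
have p0 : 0 < 4 * pi * s by rewrite !mulr_gt0.
have Dln := is_derive1_comp (is_derive1_ln p0) Dmul.
have Dinv := is_deriveV (lt0r_neq0 s0) (is_derive_id s 1).
apply: is_derive_eq (is_deriveD (is_deriveZ (- (n%:R / 2)) Dln)
  (is_deriveZ (- (q / 4)) Dinv)) _.
have := lt0r_neq0 pi0; rewrite /GRing.scale /=; move: pi => p p_neq0.
by field; rewrite p_neq0 gt_eqF.
Unshelve. all: by end_near. Qed.

(** Only coordinate [i] moves, so the exponent becomes an explicit quadratic polynomial in [h],
    convenient both to differentiate and to bound. *)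
Lemma heat_kernel_shift x y i h t :
  heat_kernel (h *: delta_mx ord0 i + x - y) t =
  (4 * pi * t) `^ (- (n%:R / 2)) * expR (- ((4 * t)^-1 *
    (enorm (x - y) ^+ 2 + 2 * h * (x ord0 i - y ord0 i) + h ^+ 2))).
Proof.
rewrite heat_kernelE !enorm_sqr; congr (_ * expR (- (_ * _))).
rewrite (bigD1 i)//= [in RHS](bigD1 i)//= !mxE !eqxx.
rewrite (eq_bigr (fun j => (x - y) ord0 j ^+ 2)) => [|j ji].
  by rewrite /=; ring.
by rewrite !mxE (negbTE ji) andbF mulr0 add0r.
Qed.

Lemma is_derive_heat_kernel_shift x y i h t : 0 < t ->
  is_derive h 1 (fun h => heat_kernel (h *: delta_mx ord0 i + x - y) t)
    (- ((x ord0 i - y ord0 i + h) / (2 * t)) *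
     heat_kernel (h *: delta_mx ord0 i + x - y) t).
Proof.
move=> t0; set d := x ord0 i - y ord0 i; set q := enorm (x - y) ^+ 2.
pose E r := - ((4 * t)^-1 * (q + 2 * r * d + r ^+ 2)).
set A := (4 * pi * t) `^ (- (n%:R / 2)).
have -> : (fun h => heat_kernel (h *: delta_mx ord0 i + x - y) t) =
    A *: (expR \o E).
  by apply/funext => r; rewrite heat_kernel_shift.
rewrite heat_kernel_shift -/A -/d -/q -/(E h).
rewrite [X in is_derive _ _ _ X](_ : _ =
  A *: (expR (E h) * (- ((d + h) / (2 * t))))); last first.
  by rewrite /GRing.scale/=; ring.
apply: is_deriveZ; apply: (is_derive1_comp (is_derive_expR (E h))).
have -> : E = (- (4 * t)^-1) *: (cst q + (2 * d) *: id + id ^+ 2).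
  apply/funext => r; rewrite /E/= !fctE.
  rewrite /GRing.scale/=; ring.
apply: (is_derive_eq (is_deriveZ _ (is_deriveD (is_deriveD
  (is_derive_cst q h 1) (is_deriveZ (2 * d) (is_derive_id h 1)))
  (is_deriveX 2 (is_derive_id h 1))))).
by rewrite /GRing.scale/=; field; rewrite gt_eqF.
Qed.

End heat_derivatives.

(** * Differentiation of the semigroup under the integral sign *)

Section heat_semigroup_derivatives.
Context {R : realType} {n : nat}.
Implicit Types (x : 'rV[R]_n) (a b c C q s t : R) (i : 'I_n).
Variable phi : 'rV[R]_n -> R.
Hypothesis phi_cont : continuous phi.
Hypothesis phi_Linfty : Linfty phi.
Hypothesis phi_ge0 : forall y, 0 <= phi y.

Local Notation mu := (@lebesgue_tuple R n).
Local Notation Y := (n.-tuple (measurableTypeR R)).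

(** Follows from [1 + c q <= expR (c q)]. It trades a factor affine in the squared distance for part
    of the Gaussian decay. *)
Lemma affine_le_expR a b c q : 0 <= a -> 0 <= b -> 0 < c -> 0 <= q ->
  a + b * q <= (a + b / c) * expR (c * q).
Proof.
move=> a0 b0 c0 q0; have bc0 : 0 <= b / c by rewrite divr_ge0// ltW.
apply: (@le_trans _ _ ((a + b / c) * (1 + c * q))).
  rewrite [leRHS](_ : _ = a + b * q + (a * (c * q) + b / c)).
    by rewrite lerDl addr_ge0// !mulr_ge0// ltW.
  by field; rewrite gt_eqF.
by rewrite ler_wpM2l ?addr_ge0// expR_ge1Dx.
Qed.

(** Common form of the time and space derivatives: a Gaussian bound on [k'], uniform for the
    parameter in []u, v[], times [phi] gives the integrable function required by dominated
    differentiation. *)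
Lemma is_derive_integral_weight (k k' : R -> Y -> R) (s u v : R) x c C :
  s \in `]u, v[ -> 0 < c ->
  (forall r, r \in `]u, v[ ->
    mu.-integrable setT (EFin \o (fun y => k r y * phi (vec y)))) ->
  (forall r y, r \in `]u, v[ -> is_derive r 1 (k ^~ y) (k' r y)) ->
  (forall r y, r \in `]u, v[ ->
    `|k' r y| <= C * expR (- (c * enorm (x - vec y) ^+ 2))) ->
  is_derive s 1 (fun r => \int[mu]_(y in setT) (k r y * phi (vec y)))
    (\int[mu]_(y in setT) (k' s y * phi (vec y))).
Proof.
move=> suv c0 ik dk bk.
have dkphi r y : r \in `]u, v[ ->
    is_derive r 1 (fun r => k r y * phi (vec y)) (k' r y * phi (vec y)).
  move=> /(dk r y) dkr.
  rewrite (_ : (fun r => _) = phi (vec y) *: (k ^~ y)); last first.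
    by apply/funext => r'; rewrite mulrC.
  by rewrite mulrC; exact: is_deriveZ.
(* The absolute value makes [G] nonnegative without a sign assumption on [C]. *)
pose G y := `|C| * expR (- (c * enorm (x - vec y) ^+ 2)) * phi (vec y).
have G0 y : 0 <= G y by rewrite !mulr_ge0// expR_ge0.
have iG : mu.-integrable setT (EFin \o G).
  apply: (@integrable_gauss_dom _ _ _ phi_cont phi_Linfty x c `|C|) => //.
    by apply: measurable_funM => //; exact: measurable_gauss.
  by move=> y; rewrite ger0_norm ?mulr_ge0// expR_ge0.
have d1E r y : r \in `]u, v[ ->
    partial1of2 (fun r y => k r y * phi (vec y)) r y = k' r y * phi (vec y).
  by move=> /(dkphi r y) H; rewrite partial1of2E derive_val.
have Gub r y : `]u, v[%classic r -> setT y ->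
    `|partial1of2 (fun r y => k r y * phi (vec y)) r y| <= G y.
  move=> ruv _; rewrite d1E// normrM [X in _ * X]ger0_norm// ler_wpM2r//.
  by rewrite (le_trans (bk r y ruv))// ler_wpM2r ?expR_ge0// ler_norm.
have der r y : `]u, v[%classic r -> setT y ->
    derivable (fun r => k r y * phi (vec y)) r 1.
  by move=> ruv _; have := dkphi r y ruv.
apply: DeriveDef.
  exact: (derivable_under_integral measurableT suv ik der G0 iG Gub).
rewrite -derive1E.
rewrite (differentiation_under_integral measurableT suv ik der G0 iG Gub).
by apply: eq_Rintegral => y _; rewrite d1E.
Qed.

Lemma is_derive_heat_time x t : 0 < t ->
  is_derive t 1 (fun s => heat_semigroup s phi x)
    (\int[mu]_(y in setT) ((enorm (x - vec y) ^+ 2 / (4 * t ^+ 2) -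
       n%:R / (2 * t)) * heat_kernel (x - vec y) t * phi (vec y))).
Proof.
move=> t0; have pi0 := pi_gt0 R.
(* Half of the Gaussian decay rate [2 c] absorbs the polynomial factor. *)
pose b := t ^- 2; pose a := n%:R / t; pose c := (16 * t)^-1.
pose A := (4 * pi * (t / 2)) `^ (- (n%:R / 2)).
have c0 : 0 < c by rewrite invr_gt0 mulr_gt0.
have a0 : 0 <= a by rewrite divr_ge0// ltW.
have b0 : 0 <= b by rewrite invr_ge0 exprn_ge0// ltW.
apply: (@is_derive_integral_weight (fun r y => heat_kernel (x - vec y) r)
  (fun r y => (enorm (x - vec y) ^+ 2 / (4 * r ^+ 2) - n%:R / (2 * r)) *
     heat_kernel (x - vec y) r) t (t / 2) (2 * t) x c
  ((a + b / c) * A)) => //.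
- by rewrite in_itv/=; apply/andP; split; lra.
- move=> r; rewrite in_itv/= => /andP[tr _].
  by apply: integrable_heat => //; lra.
- move=> r y; rewrite in_itv/= => /andP[tr _].
  by apply: is_derive_heat_kernel_time; lra.
- move=> r y; rewrite in_itv/= => /andP[tr rt].
  have r0 : 0 < r by lra.
  set q := enorm _ ^+ 2; have q0 : 0 <= q by exact: sqr_ge0.
  rewrite normrM [X in _ * X]ger0_norm ?(ltW (heat_kernel_gt0 _ r0))//.
  (* Since [r > t/2], the two terms are at most [q / t^2] and [n / t]. *)
  have H1 : `|q / (4 * r ^+ 2) - n%:R / (2 * r)| <= a + b * q.
    move: (q) q0 => {}q {}q0.
    rewrite (le_trans (ler_normB _ _))// addrC.
    rewrite !ger0_norm ?divr_ge0 ?mulr_ge0 ?sqr_ge0 ?(ltW r0)//.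
    rewrite lerD//.
      rewrite ler_pM// ?invr_ge0 ?mulr_ge0 ?(ltW r0)//.
      by rewrite lef_pV2 ?posrE//; lra.
    rewrite mulrC ler_wpM2r// lef_pV2 ?posrE ?exprn_gt0 ?mulr_gt0 ?exprn_gt0//.
    have : (t / 2) ^+ 2 <= r ^+ 2 by rewrite ler_sqr ?nnegrE; lra.
    by rewrite expr_div_n; lra.
  (* The prefactor does not increase with [r], so its value at [t/2] bounds it; the Gaussian widens
     with [r], and [r < 2t] leaves the rate [1/(8t) = 2c]. *)
  have H2 : heat_kernel (x - vec y) r <= A * expR (- (2 * c * q)).
    rewrite heat_kernelE -/q ler_pM ?powR_ge0 ?expR_ge0//.
      rewrite /A !powRN lef_pV2 ?posrE ?powR_gt0 ?mulr_gt0 ?divr_gt0//.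
      rewrite ge0_ler_powR ?divr_ge0 ?nnegrE ?mulr_ge0 ?divr_ge0 ?(ltW t0)
        ?(ltW r0) ?(ltW pi0)//.
      by rewrite ler_wpM2l ?mulr_ge0 ?(ltW pi0) ?(ltW tr).
    rewrite ler_expR lerN2 ler_wpM2r// /c.
    rewrite (_ : 2 * (16 * t)^-1 = (8 * t)^-1); last by field; rewrite gt_eqF.
    by rewrite lef_pV2 ?posrE ?mulr_gt0//; lra.
  have H3 := affine_le_expR a0 b0 c0 q0.
  apply: (le_trans (ler_pM _ _ (le_trans H1 H3) H2)) => //.
    by rewrite ltW// heat_kernel_gt0.
  rewrite [leLHS](_ : _ =
    (a + b / c) * A * (expR (c * q) * expR (- (2 * c * q)))); last by ring.
  by rewrite -expRD (_ : c * q + - (2 * c * q) = - (c * q))//; ring.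
Qed.

Lemma is_derive_heat_space x i t : 0 < t ->
  is_derive (0 : R) 1
    (fun h : R => heat_semigroup t phi (h *: delta_mx ord0 i + x))
    (\int[mu]_(y in setT) (- ((x ord0 i - tnth y i) / (2 * t)) *
       heat_kernel (x - vec y) t * phi (vec y))).
Proof.
move=> t0; have pi0 := pi_gt0 R.
pose b := (2 * t)^-1; pose a := 2 * b; pose c := (16 * t)^-1.
pose A := (4 * pi * t) `^ (- (n%:R / 2)).
have c0 : 0 < c by rewrite invr_gt0 mulr_gt0.
have b0 : 0 <= b by rewrite invr_ge0 mulr_ge0// ltW.
have a0 : 0 <= a by rewrite mulr_ge0.
pose k h (y : Y) := heat_kernel (h *: delta_mx ord0 i + x - vec y) t.
pose k' h (y : Y) := - ((x ord0 i - tnth y i + h) / (2 * t)) * k h y.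
rewrite [X in is_derive _ _ _ X](_ : _ =
    \int[mu]_(y in setT) (k' 0 y * phi (vec y))); last first.
  by apply: eq_Rintegral => y _; rewrite /k' /k scale0r add0r addr0.
apply: (@is_derive_integral_weight k k' 0 (-1) 1 x c
  ((a + b / c) * (A * expR (4 * t)^-1))) => //.
- by rewrite in_itv/=; apply/andP; split; lra.
- by move=> r _; exact: integrable_heat.
- move=> r y _.
  have := is_derive_heat_kernel_shift x (vec y) i r t0.
  by rewrite !mxE.
- move=> r y; rewrite in_itv/= => /andP[r1 r2].
  rewrite /k' /k; set d := x ord0 i - tnth y i.
  set q := enorm _ ^+ 2; have q0 : 0 <= q by exact: sqr_ge0.
  have dq : d ^+ 2 <= q by exact: coord_sub_sqr_le.
  rewrite normrM [X in _ * X]ger0_norm ?(ltW (heat_kernel_gt0 _ t0))//.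
  (* Uses [|d| <= 1 + d^2 <= 1 + q] and [|r| < 1]; hence the choice [a = 2b]. *)
  have H1 : `|- ((d + r) / (2 * t))| <= a + b * q.
    rewrite normrN normrM [X in _ * X]ger0_norm// -/b /a.
    rewrite (_ : 2 * b + b * q = (2 + q) * b); last by ring.
    rewrite ler_wpM2r// ler_norml.
    by apply/andP; split; nra.
  (* From [(d + 2r)^2 >= 0], [d^2 <= q] and [r^2 <= 1], the shifted squared distance is at least
     [q/2 - 1]. Recentring the Gaussian at [x] thus halves its rate and costs the factor
     [expR (4 * t)^-1]. *)
  have H2 : heat_kernel (r *: delta_mx ord0 i + x - vec y) t <=
      A * expR (4 * t)^-1 * expR (- (2 * c * q)).
    rewrite heat_kernel_shift -/A -[leRHS]mulrA ler_wpM2l ?powR_ge0//.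
    rewrite -expRD ler_expR !mxE -/d -/q.
    rewrite (_ : (4 * t)^-1 + _ = - ((4 * t)^-1 * (q / 2 - 1))); last first.
      by rewrite /c; field; rewrite gt_eqF.
    rewrite lerN2 ler_wpM2l ?invr_ge0 ?mulr_ge0 ?(ltW t0)//.
    have dr0 := sqr_ge0 (d + 2 * r).
    have r21 : r ^+ 2 <= 1 by nra.
    by nra.
  have H3 := affine_le_expR a0 b0 c0 q0.
  apply: (le_trans (ler_pM _ _ (le_trans H1 H3) H2)) => //.
    by rewrite ltW// heat_kernel_gt0.
  rewrite [leLHS](_ : _ = (a + b / c) * (A * expR (4 * t)^-1) *
    (expR (c * q) * expR (- (2 * c * q)))); last by ring.
  by rewrite -expRD (_ : c * q + - (2 * c * q) = - (c * q))//; ring.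
Qed.

End heat_semigroup_derivatives.

(** * Cauchy-Schwarz for a weighted integral *)

Section weighted_integrals.
Context d (T : measurableType d) (R : realType).
Variable mu : {measure set T -> \bar R}.
Implicit Types (w g : T -> R).

Lemma Rintegral_sum (I : Type) (s : seq I) (g : I -> T -> R) :
  (forall i, mu.-integrable setT (EFin \o g i)) ->
  \int[mu]_(y in setT) (\sum_(i <- s) g i y) =
  \sum_(i <- s) \int[mu]_(y in setT) g i y.
Proof.
move=> ig; elim: s => [|i s IH].
  under eq_Rintegral do rewrite big_nil.
  by rewrite big_nil Rintegral_cst// mul0r.
under eq_Rintegral do rewrite big_cons.
rewrite big_cons -IH RintegralD//.
rewrite (_ : _ \o _ = (fun y => \sum_(j <- s) (EFin \o g j) y)%E).
  exact: integrable_sum.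
by apply/funext => y; rewrite /= -sumEFin.
Qed.

(* Nonnegativity of the [w]-weighted integral of [(g - m)^2], [m] the mean. *)
Lemma sqr_Rintegral_le w g : (forall y, 0 <= w y) ->
  mu.-integrable setT (EFin \o w) ->
  mu.-integrable setT (EFin \o (fun y => g y * w y)) ->
  mu.-integrable setT (EFin \o (fun y => g y ^+ 2 * w y)) ->
  0 < \int[mu]_(y in setT) w y ->
  (\int[mu]_(y in setT) (g y * w y)) ^+ 2 <=
  \int[mu]_(y in setT) (g y ^+ 2 * w y) * \int[mu]_(y in setT) w y.
Proof.
move=> w0 iw igw iggw W0.
set W := \int[mu]_(y in setT) w y in W0 *.
set A := \int[mu]_(y in setT) (g y * w y).
set B := \int[mu]_(y in setT) (g y ^+ 2 * w y).
pose m := A / W.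
have i1 : mu.-integrable setT (EFin \o (fun y => 2 * m * (g y * w y))).
  exact: (integrableZl measurableT (2 * m) igw).
have i2 : mu.-integrable setT (EFin \o (fun y => m ^+ 2 * w y)).
  exact: (integrableZl measurableT (m ^+ 2) iw).
have i3 : mu.-integrable setT
    (EFin \o (fun y => g y ^+ 2 * w y - 2 * m * (g y * w y))).
  exact: (integrableB measurableT iggw i1).
have : 0 <= \int[mu]_(y in setT) ((g y - m) ^+ 2 * w y).
  by apply: Rintegral_ge0 => y _; rewrite mulr_ge0// sqr_ge0.
have -> : \int[mu]_(y in setT) ((g y - m) ^+ 2 * w y) =
    \int[mu]_(y in setT)
      (g y ^+ 2 * w y - 2 * m * (g y * w y) + m ^+ 2 * w y).
  by apply: eq_Rintegral => y _; ring.
rewrite RintegralD// RintegralB// !RintegralZl// -/W -/A -/B => H.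
(* Multiplying by [W > 0] clears the denominators of [m = A / W] and leaves [B W - A^2]. *)
have : 0 <= (B - 2 * m * A + m ^+ 2 * W) * W by rewrite mulr_ge0// ltW.
rewrite (_ : (B - 2 * m * A + m ^+ 2 * W) * W = B * W - A ^+ 2).
  by rewrite subr_ge0.
by rewrite /m; field; rewrite gt_eqF.
Qed.

End weighted_integrals.

(** * First and second moments of the heat weight *)

Section heat_moments.
Context {R : realType} {n : nat}.
Implicit Types (x : 'rV[R]_n) (t : R) (i : 'I_n).
Variable phi : 'rV[R]_n -> R.
Hypothesis phi_cont : continuous phi.
Hypothesis phi_Linfty : Linfty phi.

Local Notation mu := (@lebesgue_tuple R n).
Local Notation Y := (n.-tuple (measurableTypeR R)).

(** Half of the kernel's rate [1/(4t) = 2c] absorbs the quadratic growth of [p]; the other half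
    remains as dominating Gaussian. *)
Lemma integrable_heat_quadratic x t (p : Y -> R) : 0 < t ->
  measurable_fun setT p -> (forall y, `|p y| <= 1 + enorm (x - vec y) ^+ 2) ->
  mu.-integrable setT
    (EFin \o (fun y => p y * (heat_kernel (x - vec y) t * phi (vec y)))).
Proof.
move=> t0 mp pq; pose c := (8 * t)^-1.
have c0 : 0 < c by rewrite invr_gt0 mulr_gt0.
rewrite (_ : (fun y : Y => _) =
    (fun y => p y * heat_kernel (x - vec y) t * phi (vec y))); last first.
  by apply/funext => y; rewrite mulrA.
apply: (@integrable_gauss_dom _ _ _ phi_cont phi_Linfty x c
  ((1 + c^-1) * (4 * pi * t) `^ (- (n%:R / 2)))) => //.
  by apply: measurable_funM => //; exact: measurable_heat_kernel_sub.
move=> y; rewrite normrM [X in _ * X]ger0_norm ?(ltW (heat_kernel_gt0 _ t0))//.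
have := pq y; rewrite heat_kernelE; set q := enorm _ ^+ 2 => pyq.
have q0 : 0 <= q by exact: sqr_ge0.
have := affine_le_expR (@ler01 R) (@ler01 R) c0 q0; rewrite !mul1r => H.
rewrite (_ : (4 * t)^-1 * q = 2 * c * q); last first.
  by rewrite /c; field; rewrite gt_eqF.
apply: le_trans (ler_wpM2r _ (le_trans pyq H)) _.
  by rewrite mulr_ge0 ?powR_ge0 ?expR_ge0.
rewrite [leLHS](_ : _ = (1 + c^-1) * (4 * pi * t) `^ (- (n%:R / 2)) *
  (expR (c * q) * expR (- (2 * c * q)))); last by ring.
by rewrite -expRD (_ : c * q + - (2 * c * q) = - (c * q))//; ring.
Qed.

Lemma integrable_first_moment x t i : 0 < t -> mu.-integrable setT
  (EFin \o (fun y => (x ord0 i - tnth y i) *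
    (heat_kernel (x - vec y) t * phi (vec y)))).
Proof.
move=> t0; apply: integrable_heat_quadratic => // [|y].
  exact: measurable_coord_sub.
(* The elementary bound [|e| <= 1 + e^2] brings the linear factor under the quadratic one. *)
apply: le_trans (_ : _ <= 1 + (x ord0 i - tnth y i) ^+ 2) _.
  by set e := _ - _; rewrite ler_norml; apply/andP; split; nra.
by rewrite lerD2l coord_sub_sqr_le.
Qed.

(** Cauchy-Schwarz in each coordinate for the weight [w], whose total mass is the semigroup; the
    second moments of the coordinates add up to that of the Euclidean distance. *)
Lemma heat_first_moments_le x t : (forall y, 0 <= phi y) ->
  (exists y, phi y != 0) -> 0 < t ->
  let w y := heat_kernel (x - vec y) t * phi (vec y) in
  \sum_(i < n) (\int[mu]_(y in setT) ((x ord0 i - tnth y i) * w y)) ^+ 2 <=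
  \int[mu]_(y in setT) (enorm (x - vec y) ^+ 2 * w y) * heat_semigroup t phi x.
Proof.
move=> phi0 phi_neq0 t0; cbv zeta; set w := fun y : Y => _ * _.
have w0 y : 0 <= w y by rewrite mulr_ge0// ltW// heat_kernel_gt0.
have i2 i : mu.-integrable setT
    (EFin \o (fun y => (x ord0 i - tnth y i) ^+ 2 * w y)).
  apply: integrable_heat_quadratic => // [|y].
    by apply: measurable_funX; exact: measurable_coord_sub.
  rewrite ger0_norm ?sqr_ge0// (le_trans (coord_sub_sqr_le _ _ _))//.
  by rewrite lerDr.
have -> : \int[mu]_(y in setT) (enorm (x - vec y) ^+ 2 * w y) =
    \sum_(i < n) \int[mu]_(y in setT) ((x ord0 i - tnth y i) ^+ 2 * w y).
  rewrite -Rintegral_sum//; apply: eq_Rintegral => y _.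
  by rewrite enorm_sqr_subvec mulr_suml.
rewrite mulr_suml; apply: ler_sum => i _.
apply: sqr_Rintegral_le => //; first exact: integrable_heat.
  exact: integrable_first_moment.
exact: heat_semigroup_gt0.
Qed.

End heat_moments.

(** * Logarithmic derivatives and the gradient estimate *)

Lemma derive_line {R : numFieldType} {V W : normedModType R} (f : V -> W)
    (x v : V) : 'D_v f x = 'D_1 (fun h : R => f (h *: v + x)) 0.
Proof.
rewrite /derive; set g1 := fun h => h^-1 *: _; set g2 := fun h => h^-1 *: _.
suff -> : g1 = g2 by [].
by apply/funext => h; rewrite /g1 /g2 /= addr0 scale0r add0r [_%:A]mulr1.
Qed.

(** Logarithm and derivatives are total functions here, so the conclusion also asserts positivity
    and derivability; the inequality then concerns the actual logarithm and its actual
    derivatives. *)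
Theorem theorem21p3 (R : realType) (n : nat) (phi : 'rV[R]_n -> R)
    (n_ge1 : (1 <= n)%N)
    (phi_cont : continuous phi)
    (phi_Linfty : Linfty phi)
    (phi_ge0 : forall y, 0 <= phi y)
    (phi_neq0 : exists y, phi y != 0) :
  let f x t := heat_semigroup t phi x in
  let u x t := ln (f x t) in
  forall (x : 'rV[R]_n) (t : R), 0 < t ->
  [/\ 0 < f x t,
      (forall i : 'I_n, derivable (u ^~ t) x (delta_mx ord0 i)),
      derivable (u x) t 1 &
      enorm (grad (u ^~ t) x) ^+ 2 - derive1 (u x) t <= n%:R / (2 * t)].
Proof.
move=> f u x t t0.
have W0 : 0 < f x t by exact: heat_semigroup_gt0.
pose w y := heat_kernel (x - vec y) t * phi (vec y).
pose A i := \int[lebesgue_tuple n]_(y in setT) ((x ord0 i - tnth y i) * w y).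
pose B := \int[lebesgue_tuple n]_(y in setT) (enorm (x - vec y) ^+ 2 * w y).
have AB : \sum_(i < n) A i ^+ 2 <= B * f x t.
  exact: heat_first_moments_le.
have Dx i : is_derive (0 : R) 1 (fun h : R => u (h *: delta_mx ord0 i + x) t)
    ((f x t)^-1 * (- (2 * t)^-1 * A i)).
  have -> : - (2 * t)^-1 * A i =
      \int[lebesgue_tuple n]_(y in setT) (- ((x ord0 i - tnth y i) / (2 * t)) *
        heat_kernel (x - vec y) t * phi (vec y)).
    rewrite -RintegralZl//.
      by apply: eq_Rintegral => y _; rewrite /w; ring.
    exact: integrable_first_moment.
  have Df := is_derive_heat_space phi_cont phi_Linfty phi_ge0 x i t0.
  have Dln : is_derive (f (0 *: delta_mx ord0 i + x) t) 1 (@ln R) (f x t)^-1.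
    by rewrite scale0r add0r; exact: is_derive1_ln.
  exact: (@is_derive1_comp _ (@ln R)
    (fun h : R => f (h *: delta_mx ord0 i + x) t) 0 _ _ Dln Df).
have Dt : is_derive t 1 (u x)
    ((f x t)^-1 * (B / (4 * t ^+ 2) - n%:R / (2 * t) * f x t)).
  have iw : (lebesgue_tuple n).-integrable setT (EFin \o w).
    exact: integrable_heat.
  have iqw : (lebesgue_tuple n).-integrable setT
      (EFin \o (fun y => enorm (x - vec y) ^+ 2 * w y)).
    apply: integrable_heat_quadratic => // [|y].
      exact: measurable_enorm_sqr_sub.
    by rewrite ger0_norm ?sqr_ge0// lerDr.
  have -> : B / (4 * t ^+ 2) - n%:R / (2 * t) * f x t =
      \int[lebesgue_tuple n]_(y in setT) ((enorm (x - vec y) ^+ 2 /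
        (4 * t ^+ 2) - n%:R / (2 * t)) * heat_kernel (x - vec y) t *
        phi (vec y)).
    rewrite -RintegralZr// -RintegralZl// -RintegralB//.
    - by apply: eq_Rintegral => y _; rewrite /w; ring.
    - exact: (integrableZr measurableT (4 * t ^+ 2)^-1 iqw).
    - exact: (integrableZl measurableT (n%:R / (2 * t)) iw).
  have Df := is_derive_heat_time phi_cont phi_Linfty phi_ge0 x t0.
  exact: (@is_derive1_comp _ (@ln R) (f x) t _ _ (is_derive1_ln W0) Df).
split=> // [i|].
  by apply/derivable1P; have := Dx i.
rewrite derive1E derive_val enorm_sqr.
(* [derive_line] reduces each partial derivative to the one-variable derivative in [Dx]; squaring
   removes the sign. *)
under eq_bigr => i _.
  rewrite mxE derive_line derive_val.
  rewrite (_ : _ ^+ 2 = ((f x t)^-1 / (2 * t)) ^+ 2 * A i ^+ 2); last by ring.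
  over.
rewrite -mulr_sumr.
(* By [AB] the squared gradient is at most [B / (4 t^2 f)], which is exactly the second-moment part
   of [u_t]; the difference leaves [n / (2t)]. *)
apply: (@le_trans _ _ (((f x t)^-1 / (2 * t)) ^+ 2 * (B * f x t) -
  (f x t)^-1 * (B / (4 * t ^+ 2) - n%:R / (2 * t) * f x t))).
  by rewrite lerD2r ler_wpM2l// sqr_ge0.
rewrite [leLHS](_ : _ = n%:R / (2 * t))//.
by move: (f x t) W0 => W W0; field; rewrite !gt_eqF.
Qed.
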